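(* Any dividing rank with Extension (on any class of complete types) is a forking rank.
   Context: $T$ is a complete first-order theory with a monster model $\mathfrak C$ (sufficiently saturated and strongly homogeneous); all parameter sets are small subsets of $\mathfrak C$. Complete types are finitary. A class of complete types is a class $\mathfrak A$ of complete types closed under complete extensions and under conjugation by automorphisms of $\mathfrak C$. A rank on $\mathfrak A$ is a mapping $R:\mathfrak A\to\mathrm{Ord}\cup\{\infty\}$ with Heredity ($p\subseteq q$ implies $R(p)\ge R(q)$) and Isomorphism ($R(p)=R(p^f)$ for $f\in Aut(\mathfrak C)$); $p$ is ranked by $R$ if $R(p)<\infty$. A rank $R$ on $\mathfrak A$ is a dividing (resp. forking) rank if for all $p\in S(A)$, $q\in S(B)$ in $\mathfrak A$ with $p\subseteq q$, $p$ ranked, and $q$ dividing (resp. forking) over $A$, one has $R(p)>R(q)$. $R$ has Extension if for every ranked $p(x)\in S(A)$ in $\mathfrak A$ and every $B\supseteq A$, there is an extension $q(x)\in S(B)$ of $p$ with $R(p)=R(q)$. *)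

(* Defs.v *)
Set Warnings "-notation-overridden,-notation-incompatible-prefix".
From mathcomp Require Import all_boot all_order.
From mathcomp Require Import boolp classical_sets functions cardinality.
Set Implicit Arguments.
Unset Strict Implicit.
Unset Printing Implicit Defensive.

Local Open Scope classical_set_scope.
Local Open Scope card_scope.

(** * First-order logic *)

Record language := Language {
  fun_symb : Type;
  fun_arity : fun_symb -> nat;
  rel_symb : Type;
  rel_arity : rel_symb -> nat }.

(* [V] is the type of free variables.  Parameters from a structure [M] are
   treated as extra free variables, interpreted as themselves: see [pformula]. *)
Inductive term (L : language) (V : Type) : Type :=
| Var of V
| App (f : fun_symb L) of ('I_(fun_arity f) -> term L V).

(* The quantifier binds the variable [None] of [option V]. *)
Inductive formula (L : language) (V : Type) : Type :=
| Eq of term L V & term L V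
| Rel (r : rel_symb L) of ('I_(rel_arity r) -> term L V)
| Neg of formula L V
| And of formula L V & formula L V
| Ex of formula L (option V).

Definition sentence (L : language) := formula L void.

Record structure (L : language) := Structure {
  carrier :> Type;
  carrier_inhabited : inhabited carrier;
  fun_interp : forall f : fun_symb L, ('I_(fun_arity f) -> carrier) -> carrier;
  rel_interp : forall r : rel_symb L, ('I_(rel_arity r) -> carrier) -> Prop }.

Fixpoint eval (L : language) (M : structure L) (V : Type) (v : V -> M)
    (t : term L V) : M :=
  match t with
  | Var x => v x
  | App f ts => fun_interp (fun i => eval v (ts i))
  end.

Definition extend (X V : Type) (x : X) (v : V -> X) (o : option V) : X :=
  if o is Some w then v w else x.

Fixpoint sat (L : language) (M : structure L) (V : Type) (phi : formula L V) :
    (V -> M) -> Prop :=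
  match phi with
  | Eq s t => fun v => eval v s = eval v t
  | Rel r ts => fun v => rel_interp (fun i => eval v (ts i))
  | Neg psi => fun v => ~ sat psi v
  | And psi1 psi2 => fun v => sat psi1 v /\ sat psi2 v
  | Ex psi => fun v => exists x : M, sat psi (extend x v)
  end.

Fixpoint term_vars (L : language) (V : Type) (t : term L V) : set V :=
  match t with
  | Var x => [set x]
  | App f ts => [set x | exists i, term_vars (ts i) x]
  end.

Fixpoint free_vars (L : language) (V : Type) (phi : formula L V) : set V :=
  match phi with
  | Eq s t => term_vars s `|` term_vars t
  | Rel r ts => [set x | exists i, term_vars (ts i) x]
  | Neg psi => free_vars psi
  | And psi1 psi2 => free_vars psi1 `|` free_vars psi2
  | Ex psi => [set x | free_vars psi (Some x)]
  end.

Fixpoint term_rename (L : language) (V W : Type) (g : V -> W) (t : term L V) :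
    term L W :=
  match t with
  | Var x => Var L (g x)
  | App f ts => App (fun i => term_rename g (ts i))
  end.

Fixpoint rename (L : language) (V W : Type) (g : V -> W) (phi : formula L V) :
    formula L W :=
  match phi with
  | Eq s t => Eq (term_rename g s) (term_rename g t)
  | Rel r ts => Rel (fun i => term_rename g (ts i))
  | Neg psi => Neg (rename g psi)
  | And psi1 psi2 => And (rename g psi1) (rename g psi2)
  | Ex psi => Ex (rename (omap g) psi)
  end.

Definition models (L : language) (M : structure L) (T : set (sentence L)) : Prop :=
  forall sigma, T sigma -> sat sigma (of_void M).

Definition entails (L : language) (T : set (sentence L)) (sigma : sentence L) : Prop :=
  forall M : structure L, models M T -> sat sigma (of_void M).

Definition complete_theory (L : language) (T : set (sentence L)) : Prop :=
  (exists M : structure L, models M T) /\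
  (forall sigma : sentence L, entails T sigma \/ entails T (Neg sigma)).

(** * Parameters and the monster model *)

(* Formulas in the free variables x_0, ..., x_(n-1) ([inl]) with parameters in
   [P] ([inr]). *)
Definition pformula (L : language) (n : nat) (P : Type) := formula L ('I_n + P).

Definition param_map (L : language) (n : nat) (P Q : Type) (g : P -> Q)
    (phi : pformula L n P) : pformula L n Q :=
  rename (fun u => match u with inl i => inl i | inr a => inr (g a) end) phi.

Definition holds (L : language) (M : structure L) (n : nat) (phi : pformula L n M)
    (c : 'I_n -> M) : Prop :=
  sat phi (fun u => match u with inl i => c i | inr a => a end).

Definition over (L : language) (M : structure L) (n : nat) (A : set M)
    (phi : pformula L n M) : Prop :=
  forall a, free_vars phi (inr a) -> A a.

Definition realizes (L : language) (M : structure L) (n : nat)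
    (c : 'I_n -> M) (p : set (pformula L n M)) : Prop :=
  forall phi, p phi -> holds phi c.

(* Equivalently: consistent with the complete theory of [M] with all its
   elements named. *)
Definition finitely_satisfiable (L : language) (M : structure L) (n : nat)
    (p : set (pformula L n M)) : Prop :=
  forall (N : nat) (F : 'I_N -> pformula L n M), (forall i, p (F i)) ->
    exists c : 'I_n -> M, forall i, holds (F i) c.

(* The cardinal bounding small sets is that of the type [K]: |A| < |K|. *)
Definition small (K : Type) (X : Type) (A : set X) : Prop := ~ ([set: K] #<= A).

Definition automorphism (L : language) (M : structure L) (f : M -> M) : Prop :=
  [/\ bijective f,
      forall (g : fun_symb L) (a : 'I_(fun_arity g) -> M),
        f (fun_interp a) = fun_interp (f \o a) &
      forall (r : rel_symb L) (a : 'I_(rel_arity r) -> M),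
        rel_interp (f \o a) <-> rel_interp a].

Definition saturated (K : Type) (L : language) (M : structure L) : Prop :=
  forall (n : nat) (A : set M) (p : set (pformula L n M)),
    small K A -> (forall phi, p phi -> over A phi) -> finitely_satisfiable p ->
    exists c : 'I_n -> M, realizes c p.

(* Only the restriction of [f] to [A] matters. *)
Definition elementary_on (L : language) (M : structure L) (A : set M)
    (f : M -> M) : Prop :=
  forall phi : formula L M, free_vars phi `<=` A -> (sat phi id <-> sat phi f).

Definition strongly_homogeneous (K : Type) (L : language) (M : structure L) : Prop :=
  forall (A : set M) (f : M -> M), small K A -> elementary_on A f ->
    exists2 g : M -> M, automorphism g & forall a, A a -> g a = f a.

(* The first condition says |L| + aleph_0 < |K|. *)
Definition monster_model (K : Type) (L : language) (T : set (sentence L))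
    (M : structure L) : Prop :=
  [/\ small K [set: formula L nat], models M T, saturated K M &
      strongly_homogeneous K M].

(** * Types, dividing and forking *)

(* [complete_type A p] is p(x) \in S(A), with x = (x_0, ..., x_(n-1)). *)
Definition complete_type (L : language) (M : structure L) (n : nat) (A : set M)
    (p : set (pformula L n M)) : Prop :=
  [/\ forall phi, p phi -> over A phi,
      finitely_satisfiable p &
      forall phi, over A phi -> p phi \/ p (Neg phi)].

(* The conjugate p^f. *)
Definition conjugate (L : language) (M : structure L) (n : nat) (f : M -> M)
    (p : set (pformula L n M)) : set (pformula L n M) :=
  param_map f @` p.

Definition same_type (L : language) (M : structure L) (m : nat) (A : set M)
    (a b : 'I_m -> M) : Prop :=
  forall psi : pformula L m M, over A psi -> (holds psi a <-> holds psi b).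

(* For k = 0 the condition is false. *)
Definition k_inconsistent (L : language) (M : structure L) (n : nat) (k : nat)
    (phi : nat -> pformula L n M) : Prop :=
  forall j : 'I_k -> nat, injective j ->
    ~ exists c : 'I_n -> M, forall i : 'I_k, holds (phi (j i)) c.

(* [param_map a phi] is phi(x, a), where phi(x, y) is a formula without
   parameters and a is an m-tuple. *)
Definition formula_divides (L : language) (M : structure L) (n : nat) (A : set M)
    (psi : pformula L n M) : Prop :=
  exists (m : nat) (phi : pformula L n 'I_m) (a : 'I_m -> M),
    psi = param_map a phi /\
    exists (k : nat) (b : nat -> 'I_m -> M),
      (forall i, same_type A (b i) a) /\
      k_inconsistent k (fun i => param_map (b i) phi).

(* Implication is tested on realizations in [M]; for types over small sets and
   [M] saturated this is logical implication modulo the elementary diagram. *)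
Definition type_divides (L : language) (M : structure L) (n : nat) (A : set M)
    (p : set (pformula L n M)) : Prop :=
  exists2 psi : pformula L n M, formula_divides A psi &
    forall c, realizes c p -> holds psi c.

Definition type_forks (L : language) (M : structure L) (n : nat) (A : set M)
    (p : set (pformula L n M)) : Prop :=
  exists (N : nat) (F : 'I_N -> pformula L n M),
    (forall i, formula_divides A (F i)) /\
    (forall c, realizes c p -> exists i, holds (F i) c).

(** * Ranks *)

(* The domain A of a type p \in S(A) is determined by p, since a = a belongs to
   p exactly when a \in A; a class of types can thus be a family, indexed by the
   length n of the variable tuple, of sets of sets of formulas. *)
Definition type_class (K : Type) (L : language) (M : structure L)
    (C : forall n, set (set (pformula L n M))) : Prop :=
  [/\ forall n (p : set (pformula L n M)), C n p ->
        exists2 A, small K A & complete_type A p,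
      forall n (p q : set (pformula L n M)) (B : set M), C n p -> small K B ->
        complete_type B q -> p `<=` q -> C n q &
      forall n (p : set (pformula L n M)) (f : M -> M), C n p -> automorphism f ->
        C n (conjugate f p)].

(* [option Ord] is Ord with a top element infinity = [None] added. *)
Definition rank_ge (d : Order.disp_t) (Ord : orderType d) (a b : option Ord) : Prop :=
  match a, b with
  | None, _ => True
  | Some _, None => False
  | Some x, Some y => (y <= x)%O
  end.

Definition rank_gt (d : Order.disp_t) (Ord : orderType d) (a b : option Ord) : Prop :=
  rank_ge a b /\ a <> b.

(* Here and below, the values of [R] outside the class [C] are irrelevant. *)
Definition is_rank (L : language) (M : structure L)
    (C : forall n, set (set (pformula L n M)))
    (d : Order.disp_t) (Ord : orderType d)
    (R : forall n, set (pformula L n M) -> option Ord) : Prop :=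
  (forall n (p q : set (pformula L n M)), C n p -> C n q -> p `<=` q ->
     rank_ge (R n p) (R n q)) /\
  (forall n (p : set (pformula L n M)) (f : M -> M), C n p -> automorphism f ->
     R n p = R n (conjugate f p)).

Definition dividing_rank (K : Type) (L : language) (M : structure L)
    (C : forall n, set (set (pformula L n M)))
    (d : Order.disp_t) (Ord : orderType d)
    (R : forall n, set (pformula L n M) -> option Ord) : Prop :=
  is_rank C R /\
  forall n (A B : set M) (p q : set (pformula L n M)),
    small K A -> small K B -> complete_type A p -> complete_type B q ->
    C n p -> C n q -> p `<=` q -> R n p <> None -> type_divides A q ->
    rank_gt (R n p) (R n q).

Definition forking_rank (K : Type) (L : language) (M : structure L)
    (C : forall n, set (set (pformula L n M)))
    (d : Order.disp_t) (Ord : orderType d)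
    (R : forall n, set (pformula L n M) -> option Ord) : Prop :=
  is_rank C R /\
  forall n (A B : set M) (p q : set (pformula L n M)),
    small K A -> small K B -> complete_type A p -> complete_type B q ->
    C n p -> C n q -> p `<=` q -> R n p <> None -> type_forks A q ->
    rank_gt (R n p) (R n q).

Definition has_extension (K : Type) (L : language) (M : structure L)
    (C : forall n, set (set (pformula L n M)))
    (d : Order.disp_t) (Ord : orderType d)
    (R : forall n, set (pformula L n M) -> option Ord) : Prop :=
  forall n (A B : set M) (p : set (pformula L n M)),
    small K A -> small K B -> complete_type A p -> C n p -> R n p <> None ->
    A `<=` B ->
    exists q : set (pformula L n M),
      [/\ complete_type B q, p `<=` q & R n p = R n q].

(* Main.v *)
(* Suppose q forks over A, as witnessed by finitely many dividing formulas F i,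
   and R p = R q. Extend q with the same rank to a complete type q' over B and
   the parameters of the F i. Any realization of q' satisfies some F i, and q'
   decides F i, so q' itself divides over A; hence R p > R q', contradicting
   R p = R q = R q'. *)

Require Import Defs.
From mathcomp Require Import all_boot all_order.
From mathcomp Require Import boolp classical_sets functions cardinality.

Set Implicit Arguments.
Unset Strict Implicit.
Unset Printing Implicit Defensive.

Local Open Scope classical_set_scope.
Local Open Scope card_scope.

Lemma countableU (T : Type) (A B : set T) :
  countable A -> countable B -> countable (A `|` B).
Proof.
move=> cA cB.
have -> : A `|` B = \bigcup_(b in [set: bool]) (if b then A else B).
  apply/seteqP; split=> [x [Ax|Bx]|x [[] _ ?]]; by
    [exists true | exists false | left | right].
by apply: bigcup_countable => [|[] _]; first exact: countableP.
Qed.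

Lemma card_le_setD_finite (T : Type) (A S : set T) :
  infinite_set A -> finite_set S -> A #<= A `\` S.
Proof.
elim/Ppointed: T => T in A S *; first by rewrite !emptyE.
move=> infA finS.
(* Hilbert's hotel: [range f], with [f : nat -> A `\` S] injective, has room
   for the guests from [S]. *)
have /infiniteP/pcard_leP[f] := infinite_setD infA finS.
pose V := range f `|` S.
have /pcard_injP[g injg] : countable V.
  apply: countableU; last exact: finite_set_countable.
  exact: (card_le_trans (card_image_le f setT)).
have fD n : (A `\` S) (f n) by exact: funS.
(* [g] numbers the points of [V], and [f] sends these numbers back into [V] but off [S]. So [s] is
   injective on [V], and [V] and its complement do not get mixed. *)
pose s x := if pselect (V x) then f (g x) else x.
have sV x : V x -> s x = f (g x) by rewrite /s; case: pselect.
have sNV x : ~ V x -> s x = x by rewrite /s; case: pselect.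
apply/pcard_leP/injfunPex; exists s => [x Ax|x y _ _].
  have [Vx|nVx] := pselect (V x); first by rewrite sV.
  by rewrite sNV//; split=> // Sx; apply: nVx; right.
have rV n : V (f n) by left; exists n.
have [Vx|nVx] := pselect (V x); have [Vy|nVy] := pselect (V y).
- rewrite !sV// => /(@inj _ _ _ f) fxy.
  by apply: injg; rewrite ?inE//; apply: fxy; rewrite inE.
- by rewrite sV// sNV// => fxy; case: nVy; rewrite -fxy.
- by rewrite sNV// sV// => fxy; case: nVx; rewrite fxy.
- by rewrite !sNV.
Qed.

(** An embedding of [K] makes the union infinite; deleting [S] then costs no cardinality and leaves
    a subset of [B]. *)
Lemma small_setU_finite (K X : Type) (B S : set X) :
  infinite_set [set: K] -> small K B -> finite_set S -> small K (B `|` S).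
Proof.
move=> infK smB finS leK; apply: smB; apply: (card_le_trans leK).
have infBS : infinite_set (B `|` S) by move=> /(card_le_finite leK).
apply: (card_le_trans (card_le_setD_finite infBS finS)).
by apply: subset_card_le => x [[]].
Qed.

(** A finite [K] would embed in the formulas, as the equations [x_n = x_n] are already infinitely
    many. *)
Lemma monster_infinite (K : Type) (L : language) (T : set (sentence L))
    (M : structure L) :
  monster_model K T M -> infinite_set [set: K].
Proof.
move=> [smF _ _ _] finK; apply: smF.
apply: (card_le_trans (finite_set_countable finK)).
have /injfunPex[f] : exists2 f : nat -> formula L nat,
    set_fun setT setT f & set_inj setT f.
  by exists (fun n => Eq (Var L n) (Var L n)) => // m n _ _ [].
exact: inj_card_le f.
Qed.

Lemma finite_term_vars (L : language) (V : Type) (t : term L V) :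
  finite_set (term_vars t).
Proof.
elim: t => [x|f ts IH] /=; first exact: finite_set1.
have -> : [set x | exists i, term_vars (ts i) x] =
    \bigcup_(i in setT) term_vars (ts i).
  by apply/seteqP; split=> x [i]; exists i.
by apply: bigcup_finite => // i _; apply: IH.
Qed.

Lemma finite_free_vars (L : language) (V : Type) (phi : formula L V) :
  finite_set (free_vars phi).
Proof.
elim: phi => {V} [V s t|V r ts|V phi IH|V phi IH psi IH'|V phi IH] //=.
- by rewrite finite_setU; split; exact: finite_term_vars.
- have -> : [set x | exists i, term_vars (ts i) x] =
      \bigcup_(i in setT) term_vars (ts i).
    by apply/seteqP; split=> x [i]; exists i.
  by apply: bigcup_finite => // i _; exact: finite_term_vars.
- by rewrite finite_setU.
- by apply: (finite_preimage _ IH) => x y _ _ [].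
Qed.

(** Saturation gives a realization of [q]. It satisfies some [F i], so [q] cannot contain the
    negation of that [F i]. *)
Lemma complete_type_implied (K : Type) (L : language) (M : structure L)
    (n N : nat) (B : set M) (q : set (pformula L n M))
    (F : 'I_N -> pformula L n M) :
  saturated K M -> small K B -> complete_type B q -> (forall i, Defs.over B (F i)) ->
  (forall c, realizes c q -> exists i, holds (F i) c) -> exists i, q (F i).
Proof.
move=> satM smB [overq fsq decq] overF impF.
have [c cq] := satM _ _ _ smB overq fsq.
have [i Fic] := impF c cq; exists i.
by case: (decq _ (overF i)) => // /cq.
Qed.

(* Instead of fixing the class of ordinals, [Ord] ranges over all well-ordered
   types. *)
Theorem proposition2p18 :
  forall (L : language) (T : set (sentence L)), complete_theory T ->
  forall (K : Type) (M : structure L), monster_model K T M ->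
  forall C : (forall n : nat, set (set (pformula L n M))), type_class K C ->
  forall (d : Order.disp_t) (Ord : orderType d),
    well_founded (fun a b : Ord => (a < b)%O) ->
  forall R : (forall n : nat, set (pformula L n M) -> option Ord),
    dividing_rank K C R -> has_extension K C R -> forking_rank K C R.
Proof.
move=> L T _ K M monM C [_ extC _] d Ord _ R [rankR divR] extR.
split=> // n A B p q smA smB ctp ctq Cp Cq pq Rp [N [F [divF impF]]].
(* Heredity gives the weak inequality; what remains is to refute equality of the ranks. *)
split=> [|Rpq]; first by case: rankR => her _; exact: her.
pose S := \bigcup_(i in [set: 'I_N]) [set a | free_vars (F i) (inr a)].
have finS : finite_set S.
  apply: bigcup_finite => // i _; apply: finite_preimage (finite_free_vars _).
  by move=> x y _ _ [].
have smBS : small K (B `|` S).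
  exact: small_setU_finite (monster_infinite monM) smB finS.
(* Extension applies to ranked types only; [q] is ranked because of the assumed equality. *)
have Rq : R n q <> None by rewrite -Rpq.
have [q' [ctq' qq' Rqq']] :=
  extR _ _ _ _ smB smBS ctq Cq Rq (@subsetUl _ B S).
have Cq' : C n q' by exact: extC smBS ctq' qq'.
have [_ _ satM _] := monM.
have [||i q'Fi] := complete_type_implied (F := F) satM smBS ctq'.
- by move=> i a Fia; right; exists i.
- by move=> c cq'; apply: impF => phi /qq'; exact: cq'.
have divq' : type_divides A q' by exists (F i) => // c; exact.
have [_] := divR _ _ _ _ _ smA smBS ctp ctq' Cp Cq' (subset_trans pq qq')
  Rp divq'.
by rewrite Rpq.
Qed.
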